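(* Assume that $E$ is not compact and that the following two conditions hold. (i) The mapping $E\times U\ni(x,a)\mapsto \mathbb{P}^a(x,\cdot)$ is continuous in variation norm, i.e. whenever $a_k\to a$ in $U$ and $x_k\to x$ in $E$, then $\sup_{A\in\mathcal{E}}|\mathbb{P}^{a_k}(x_k,A)-\mathbb{P}^a(x,A)|\to 0$ as $k\to\infty$. (ii) For each $n\in\mathbb{N}$, each $x\in B_n$ and each open set $O\subset E$ with $O\cap B_n\neq\emptyset$ there are $m\in\mathbb{N}$ and $a_1,\ldots,a_m\in U$ such that $(\hat{\mathbb{P}}_n^{a_1,\ldots,a_m})^m(x,O)>0$. For each $n\in\mathbb{N}$ let $w_n\in C(E)$ and $\lambda_n\in\mathbb{R}$ (which exist under (i) and (ii)) satisfy $$e^{w_n(x)}=\sup_{a\in U}\left[e^{c_n(x,a)-\lambda_n}\int_E e^{w_n(y)}\,\tilde{\mathbb{P}}_n^a(x,dy)\right]\ \ (x\in E),\qquad \sup_{x\in B_{n+1}}w_n(x)=0,$$ and let $\lambda:=\limsup_{n\to\infty}\lambda_n$. Assume moreover that at least one of the following holds: (iii) there is $\varepsilon>0$ such that the set $\{x\in E:\hat c(x)\ge\lambda-\varepsilon\}$ is compact, where $\hat c(x):=\sup_{a\in U}c(x,a)$; (iv) there are $x\in E$, $m,N\in\mathbb{N}$, $\varepsilon>0$ and $a_1,\ldots,a_m\in U$ such that $\inf_{n\ge N}(\hat{\mathbb{P}}_n^{a_1,\ldots,a_m})^m(x,\mathcal{O}_n(\varepsilon))>0$, where $\mathcal{O}_n(\varepsilon)=\{y\in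 E:e^{w_n(y)}>\varepsilon\}$. Then there is a continuous function $w:E\to\mathbb{R}$ such that $\sup_{x\in E}w(x)=0$ and $$e^{w(x)}=\sup_{a\in U}\left[e^{c(x,a)-\lambda}\int_E e^{w(y)}\,\mathbb{P}^a(x,dy)\right]\quad\text{for all }x\in E.$$
   Context: Setting. $(E,\rho)$ is a locally compact separable metric space with Borel $\sigma$-field $\mathcal{E}$; $b\in E$ is a fixed point, $\mathbb{N}$ is the set of positive integers, $B_n:=\{x\in E:\rho(b,x)\le n\}$ for $n\in\mathbb{N}$, and each $B_n$ is compact. $U$ is a nonempty compact metric space (set of control parameters). For $x\in E$, $a\in U$, $\mathbb{P}^a(x,\cdot)$ is a probability measure on $(E,\mathcal{E})$, and $(x,a)\mapsto\mathbb{P}^a(x,D)$ is Borel measurable for each $D\in\mathcal{E}$. The function $c:E\times U\to\mathbb{R}$ is continuous, bounded and not constant; $\bar c:=\sup_{x\in E,a\in U}c(x,a)$, $\underline c:=\inf_{x\in E,a\in U}c(x,a)$, and $\bar c\ge 0$. $C(E)$ is the space of bounded continuous real functions on $E$. Approximating objects. $\mu$ is a fixed probability measure on $E$ with support $D\subset B_1$. $\rho(x,B_n)$ is the distance from $x$ to $B_n$, $(\cdot)^+$ is the positive part, $s\wedge t=\min\{s,t\}$, $B_n^c=E\setminus B_n$. For $n\in\mathbb{N}$, $x\in E$, $a\in U$, $A\in\mathcal{E}$: $$\tilde{\mathbb{P}}_n^a(x,A)=(1-\rho(x,B_n))^+\mathbb{P}^a(x,A\cap B_n)+\mu(A)\left[\mathbb{P}^a(x,B_n^c)+(\rho(x,B_n)\wedge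 1)(1-\mathbb{P}^a(x,B_n^c))\right],$$ $$c_n(x,a)=(1-\rho(x,B_n))^+c(x,a)+(\rho(x,B_n)\wedge 1)\,\underline c .$$ Subtransition kernels: $\hat{\mathbb{P}}_n^{a}(x,A):=\mathbb{P}^a(x,A\cap B_n)$ (this is the case $m=1$ of $(\hat{\mathbb{P}}_n^{a_1,\ldots,a_m})^m$), and inductively $$(\hat{\mathbb{P}}_n^{a_1,\ldots,a_m})^m(x,A):=\int_{B_n}(\hat{\mathbb{P}}_n^{a_2,\ldots,a_m})^{m-1}(y,A)\,\mathbb{P}^{a_1}(x,dy).$$ *)

(* Defs.v *)
From HB Require Import structures.
From mathcomp Require Import all_boot all_order all_algebra.
From mathcomp Require Import all_classical all_reals all_analysis.
From mathcomp Require Import measurable_realfun.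

Set Implicit Arguments.
Unset Strict Implicit.
Unset Printing Implicit Defensive.

Import Order.TTheory GRing.Theory Num.Theory.
Import numFieldNormedType.Exports.

Local Open Scope classical_set_scope.
Local Open Scope ring_scope.

(* Nonempty metric spaces.  Measurable types are pointed in the library, hence
   so are the spaces that carry a Borel sigma-field; the distinguished point
   plays no other role. *)
#[short(type="pmetricType")]
HB.structure Definition PMetric (K : numDomainType) :=
  {M of Pointed M & Metric K M}.

Notation borel T := (g_sigma_algebraType (@open T%type)).

Definition msupport (R : realType) (T : ptopologicalType)
    (mu : set (borel T) -> \bar R) : set T :=
  [set x | forall O : set T, open O -> O x -> (0 < mu O)%E].

Section balls.
Context (R : realType) (E : pmetricType R).

(* [closed_ball] of the library is the closure of the open ball, which may be
   smaller in a general metric space. *)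
Definition mcball (b : E) (n : nat) : set E := [set x | mdist b x <= n%:R].

Definition mdist_set (x : E) (A : set E) : R := inf [set mdist x y | y in A].

Lemma mdist_set_ge0 x A : 0 <= mdist_set x A.
Proof.
have [->|/set0P[a Aa]] := eqVneq A set0; first by rewrite /mdist_set image_set0 inf0.
apply: lb_le_inf; first by exists (mdist x a); exists a.
by move=> _ [y _ <-]; exact: mdist_ge0.
Qed.

Lemma measurable_mcball b n : measurable (mcball b n : set (borel E)).
Proof.
rewrite -[X in measurable X]setCK; apply: measurableC; apply: sub_gen_smallest.
rewrite openE /= => x /= /negP; rewrite -ltNge => nx.
rewrite /interior -nbhs_ballE; exists (mdist b x - n%:R); first by rewrite /= subr_gt0.
move=> y; rewrite ballEmdist /= => xy; apply/negP; rewrite -ltNge.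
have := metric_triangle b y x; rewrite (metric_sym y x) => bx.
by rewrite -(ltrD2r (mdist x y)) (lt_le_trans _ bx)// -ltrBrDl.
Qed.

End balls.

Section approximation.
Context (R : realType) (E U : pmetricType R) (b : E).
Context (P : U -> E -> probability (borel E) R) (mu : probability (borel E) R).
Context (c : E * U -> R).
Local Notation B := (mcball b).

Definition c_approx (n : nat) (x : E) (a : U) : R :=
  Num.max (1 - mdist_set x (B n)) 0 * c (x, a) +
  Num.min (mdist_set x (B n)) 1 * inf (range c).

Definition P_approx (n : nat) (a : U) (x : E) (A : set (borel E)) : \bar R :=
  ((Num.max (1 - mdist_set x (B n)) 0)%:E * P a x (A `&` B n) +
   mu A * (P a x (~` B n) +
           (Num.min (mdist_set x (B n)) 1)%:E * (1 - P a x (~` B n))))%E.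

(* The subtransition kernel along the controls [a :: s], so that the number of
   steps is [m = (size s).+1 >= 1]. *)
Fixpoint P_hat (n : nat) (a : U) (s : seq U) (x : E) (A : set (borel E)) :
    \bar R :=
  if s is a' :: s' then (\int[P a x]_(y in B n) P_hat n a' s' y A)%E
  else P a x (A `&` B n).

Section P_approx_measure.
Variables (n : nat) (a : U) (x : E).

Let mB : measurable (B n : set (borel E)) := measurable_mcball b n.

Let r1_ge0 : 0 <= Num.max (1 - mdist_set x (B n)) 0.
Proof. by rewrite le_max lexx orbT. Qed.

Let r2_ge0 : 0 <= fine (P a x (~` B n)) +
  Num.min (mdist_set x (B n)) 1 * (1 - fine (P a x (~` B n))).
Proof.
have mC : measurable (~` B n : set (borel E)) by exact: measurableC.
rewrite addr_ge0 ?fine_ge0// mulr_ge0//.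
  by rewrite le_min mdist_set_ge0 ler01.
rewrite subr_ge0 -lee_fin fineK ?probability_le1//.
exact: fin_num_measure.
Qed.

Let Q : {measure set (borel E) -> \bar R} :=
  measure_add (mscale (NngNum r1_ge0) (mrestr (P a x) mB))
              (mscale (NngNum r2_ge0) mu).

Let P_approxE : P_approx n a x = Q.
Proof.
have mC : measurable (~` B n : set (borel E)) by exact: measurableC.
apply/funext => A; rewrite [RHS]measure_addE /mscale /= /P_approx /mrestr.
congr (_ + _)%E; rewrite muleC; congr (_ * _)%E.
by rewrite EFinD EFinM EFinB fineK// fin_num_measure.
Qed.

Let P_approx0 : P_approx n a x set0 = 0%E.
Proof. by rewrite P_approxE measure0. Qed.

Let P_approx_ge0 A : (0 <= P_approx n a x A)%E.
Proof. by rewrite P_approxE measure_ge0. Qed.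

Let P_approx_sigma_additive : semi_sigma_additive (P_approx n a x).
Proof. by rewrite P_approxE; exact: measure_semi_sigma_additive. Qed.

HB.instance Definition _ := isMeasure.Build _ _ _ (P_approx n a x)
  P_approx0 P_approx_ge0 P_approx_sigma_additive.

End P_approx_measure.

End approximation.

(* Main.v *)
Require Import Defs.
From HB Require Import structures.
From mathcomp Require Import all_boot all_order all_algebra.
From mathcomp Require Import all_classical all_reals all_analysis.
From mathcomp Require Import measurable_realfun ring lra.

(* Put [h_n = exp w_n].  On [B_n] it solves the Bellman equation
   [h_n = sup_a e^(c - lambda_n) int F_n dP^a], where [F_n] agrees with [h_n] on
   [B_n] and is the constant [int h_n dmu] outside; moreover [0 <= F_n <= 1] and
   [inf c <= lambda_n <= sup c].  Continuity in total variation makes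
   [(x, a) |-> e^c(x,a) int f dP^a(x)] continuous uniformly in [f] with values in
   [[0, 1]], so that the [h_n] are equicontinuous at each point.  Along an
   ultrafilter [G] finer than [\oo] with [lambda_n --> lambda], compactness of
   [[0, 1]] gives a pointwise limit [h] without any diagonal extraction;
   equicontinuity makes the convergence locally uniform, and compactness of [U]
   provides limits of near-optimal controls, so [h] solves the limit equation.
   It is not identically zero: under (iii) near-maximisers [x_n] of [h_n] lie in a
   fixed compact set, hence cluster; under (iv) iterating the equation bounds
   [h_n x] from below.  Then (ii) propagates positivity to every point, and
   [w = ln (h / sup h)]. *)

Set Implicit Arguments.
Unset Strict Implicit.
Unset Printing Implicit Defensive.

Import Order.TTheory GRing.Theory Num.Theory.
Import numFieldNormedType.Exports.

Local Open Scope classical_set_scope.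
Local Open Scope ring_scope.

(** * Expectations under probability measures *)

Section probability_expectation.
Context d (T : measurableType d) (R : realType).
Implicit Types (P Q : probability T R) (f g : T -> R).

Definition unit_mfun (f : T -> R) :=
  measurable_fun setT f /\ forall y, 0 <= f y <= 1.

Lemma bounded_mfun_integrable P f (M : R) : measurable_fun setT f ->
  (forall y, `|f y| <= M) -> P.-integrable setT (EFin \o f).
Proof.
move=> mf fM; apply: measurable_bounded_integrable => //.
  by rewrite ltey_eq fin_num_measure.
exists M; split; first exact: num_real.
by move=> N MN x _ /=; rewrite (le_trans (fM x))// ltW.
Qed.

Lemma unit_integrable P f : unit_mfun f -> P.-integrable setT (EFin \o f).
Proof.
move=> [mf f01]; apply: (@bounded_mfun_integrable _ _ 1) => // y.
by have /andP[f0 f1] := f01 y; rewrite ger0_norm.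
Qed.

Lemma Rintegral_cst_prob P (r : R) : \int[P]_y r = r.
Proof. rewrite Rintegral_cst// -[RHS]mulr1; congr (_ * _).
by have := @probability_setT _ _ _ P => /= ->. Qed.

Lemma Rintegral_unit P f : unit_mfun f -> 0 <= \int[P]_y f y <= 1.
Proof.
move=> uf; have [mf f01] := uf; apply/andP; split.
  by apply: Rintegral_ge0 => y _; case/andP: (f01 y).
rewrite -[leRHS](Rintegral_cst_prob P 1); apply: le_Rintegral => //.
- exact: unit_integrable.
- by apply: (@bounded_mfun_integrable _ _ 1) => // y; rewrite normr1.
- by move=> y _; case/andP: (f01 y).
Qed.

Lemma Rintegral_EFin P f : unit_mfun f ->
  (\int[P]_y (f y)%:E)%E = (\int[P]_y f y)%:E.
Proof.
move=> uf; rewrite fineK//.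
exact: (integrable_fin_num measurableT (unit_integrable P uf)).
Qed.

Lemma Rintegral_indicT P (A : set T) : measurable A ->
  \int[P]_y \1_A y = fine (P A).
Proof. by move=> mA; rewrite /Rintegral integral_indic// setIT. Qed.

Lemma unit_mfun_indic (A : set T) : measurable A -> unit_mfun \1_A.
Proof.
move=> mA; split; first exact: measurable_indic.
by move=> y; rewrite indicE; case: (y \in A); rewrite ?lexx ler01.
Qed.

(* Halving: [f = (\1_[f >= 1/2] + g) / 2] with [g] again valued in [[0, 1]], so
   that the discrepancy of [f] is at most the average of [e] and that of [g]. *)
Lemma Rintegral_total_variation P Q (e : R) :
  (forall A, measurable A -> `|fine (P A) - fine (Q A)| <= e) ->
  forall f, unit_mfun f -> `|\int[P]_y f y - \int[Q]_y f y| <= e.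
Proof.
(* The defect [2^-1 ^+ k] is one at [k = 0], where both expectations lie in [[0, 1]], and each
   halving divides it by two. *)
move=> PQe f uf; suff H (k : nat) g : unit_mfun g ->
    `|\int[P]_y g y - \int[Q]_y g y| <= e + 2^-1 ^+ k.
  apply/ler_addgt0Pr => r r0.
  have : (2^-1 : R) ^+ k @[k --> \oo] --> (0 : R).
    by apply: cvg_expr; rewrite ger0_norm; lra.
  move=> /cvgrPdist_lt/(_ _ r0) [k _ /(_ k (leqnn k))].
  rewrite sub0r normrN (@ger0_norm _ (2^-1 ^+ k)) ?exprn_ge0 ?invr_ge0//.
  by move=> kr; rewrite (le_trans (H k f uf))// lerD2l ltW.
have e0 : 0 <= e by exact: le_trans (PQe set0 measurable0).
elim: k g {f uf} => [|k IH] f uf.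
  have := Rintegral_unit P uf; have := Rintegral_unit Q uf; rewrite expr0.
  by move=> /andP[? ?] /andP[? ?]; rewrite ler_norml; lra.
have [mf f01] := uf.
pose A := f @^-1` `[2^-1, +oo[.
have mA : measurable A by rewrite -[A]setTI; exact: mf.
pose g := fun y => 2 * f y - \1_A y.
have ug : unit_mfun g.
  split.
    apply: measurable_funB; last exact: measurable_indic.
    by apply: measurable_funM => //; exact: measurable_cst.
  move=> y; rewrite /g indicE; have /andP[f0 f1] := f01 y.
  have [yA|yA] := boolP (y \in A).
    by move: yA; rewrite inE /A /= in_itv /= andbT => yA; lra.
  move/negP: yA; rewrite inE /A /= in_itv /= andbT => /negP; rewrite -ltNge => yA.
  by lra.
have uA := unit_mfun_indic mA.
have fE : forall y, f y = 2^-1 * (\1_A y + g y) by move=> y; rewrite /g; field.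
have IE (S : probability T R) :
    \int[S]_y f y = 2^-1 * (fine (S A) + \int[S]_y g y).
  rewrite -(Rintegral_indicT S mA) -RintegralD//; try exact: unit_integrable.
  rewrite -RintegralZl//; first by apply: eq_Rintegral => y _; exact: fE.
  apply: (@bounded_mfun_integrable _ _ 2).
    by apply: measurable_funD; [case: uA|case: ug].
  move=> y; case: uA => _ /(_ y) /andP[? ?]; case: ug => _ /(_ y) /andP[? ?].
  by rewrite ger0_norm; lra.
rewrite !IE -mulrBr normrM ger0_norm; last by lra.
have -> : forall a b c d : R, a + b - (c + d) = (a - c) + (b - d) by move=> *; ring.
rewrite exprS.
have := ler_normD (fine (P A) - fine (Q A)) (\int[P]_y g y - \int[Q]_y g y).
have := PQe A mA; have := IH g ug; set u := `|_ + _|; set v := `|_|; set z := `|_|.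
by move: (2^-1 ^+ k) => t; lra.
Qed.

(* Unlike [ge0_le_integral], no measurability: this is what allows integrating
   [P_hat] without showing that it is measurable. *)
Lemma ge0_le_integral_nonmeas (m : {measure set T -> \bar R}) (D : set T)
    (f1 f2 : T -> \bar R) :
  (forall x, D x -> 0 <= f1 x)%E ->
  (forall x, D x -> f1 x <= f2 x)%E ->
  (\int[m]_(x in D) f1 x <= \int[m]_(x in D) f2 x)%E.
Proof.
move=> f10 f12; rewrite !(integral_mkcond D).
have f20 x : (0 <= (f2 \_ D) x)%E.
  by apply: erestrict_ge0 => // t /[dup] Dt /f12; apply: le_trans; exact: f10.
have f10' x : (0 <= (f1 \_ D) x)%E by apply: erestrict_ge0.
rewrite !ge0_integralTE//; apply: ereal_sup_le => _ [h hf <-]; exists h => // x.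
rewrite (le_trans (hf x))// !patchE; case: ifPn => // xD.
by apply: f12; exact/set_mem.
Qed.

(** The restricted measure agrees with [m] on subsets of [D] and vanishes on subsets of the
    complement. *)
Lemma integral_mrestr (m : {measure set T -> \bar R}) (D : set T)
    (mD : measurable D) (f : T -> \bar R) :
  (forall x, 0 <= f x)%E -> measurable_fun setT f ->
  (\int[mrestr m mD]_x f x = \int[m]_(x in D) f x)%E.
Proof.
move=> f0 mf.
have mC : measurable (~` D) by exact: measurableC.
rewrite -(setUv D) ge0_integral_setU//=; last 2 first.
- by rewrite setUv.
- by rewrite disj_set2E setICr.
rewrite (@eq_measure_integral _ _ _ _ m (mrestr m mD)); last first.
  by move=> A mA AD; rewrite /= /mrestr setIidl.
rewrite [X in (_ + X)%E](_ : _ = 0%E) ?adde0//.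
rewrite (@eq_measure_integral _ _ _ _ mzero) ?integral_measure_zero//.
by move=> A mA AD; rewrite /= /mrestr (disjoints_subset _ _).2// measure0.
Qed.

End probability_expectation.

(** * Borel sets of metric spaces and the approximating kernels *)

Section borel_metric.
Context (R : realType) (E : pmetricType R).

Lemma open_borel (O : set E) : open O -> measurable (O : set (borel E)).
Proof. exact: sub_gen_smallest. Qed.

Lemma continuous_borel (f : E -> R) : continuous f ->
  measurable_fun [set: borel E] (f : borel E -> R).
Proof.
move=> /continuousP cf; apply: (measurability _ (RGenOpens.measurableE R)).
move=> _ [_ [a [c ->] <-]]; rewrite setTI; apply: open_borel.
by apply: cf; exact: interval_open.
Qed.

Lemma open_mball (x : E) (r : R) : open (ball x r).
Proof.
rewrite openE => y; rewrite ballEmdist /= => xy.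
apply/nbhs_ballP; exists (r - mdist x y); first by rewrite /= subr_gt0.
move=> z; rewrite !ballEmdist /= ltrBrDl.
by apply: le_lt_trans; exact: metric_triangle.
Qed.

(** Each point off the support has a null open neighbourhood, and by separability countably many
    null balls with centres in [S] and radii [1 / (j + 1)] cover all such points. *)
Lemma borel_supported (mu : probability (borel E) R) (D : set E) :
  (exists2 S : set E, countable S & dense S) ->
  measurable (D : set (borel E)) -> msupport mu `<=` D -> mu (~` D) = 0%E.
Proof.
move=> [S cS dS] mD suppD.
have [s0 [_ Ss0]] : [set: E] `&` S !=set0.
  by apply: dS; [exists point|exact: openT].
have /(@pfcard_geP _ _ _ _) [S0|[f]] := cS.
  by move: Ss0; rewrite S0.
(* Centre and radius are coded by one natural number; the decoding default [(0, 0)] is harmless,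
   since every [V ij] is null by construction. *)
pose V (ij : nat) : set E := 
  let: (i, j) := odflt (0, 0)%N (unpickle ij) in
  if mu (ball (f i) (j.+1%:R^-1)) == 0%E then ball (f i) (j.+1%:R^-1) else set0.
have oV ij : open (V ij).
  rewrite /V; case: (odflt _ _) => i j.
  by case: ifP => _; [exact: open_mball|exact: open0].
have V0 ij : mu (V ij) = 0%E.
  by rewrite /V; case: (odflt _ _) => i j; case: ifPn => [/eqP|_]; rewrite ?measure0.
have nV : mu.-negligible (\bigcup_ij (V ij)).
  apply: (@negligible_bigcup _ (borel E) _ mu V) => ij.
  exact: (negligibleP mu (open_borel (oV ij))).2 (V0 ij).
suff : ~` D `<=` \bigcup_ij (V ij).
  move=> DV; apply/negligibleP; first exact: measurableC.
  exact: negligibleS nV.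
move=> x Dx.
have [ O [oO Ox O0]] : exists O : set E, [/\ open O, O x & mu O = 0%E].
  apply/not_existsP => H; apply: Dx; apply: suppD => O oO Ox.
  rewrite lt0e measure_ge0 andbT; apply/eqP => O0.
  by apply: (H O).
have /nbhs_ballP[r /= r0 xr] : nbhs x O by exact: open_nbhs_nbhs.
(* With a radius below [r / 2], the ball about any centre within that distance of [x] contains [x]
   and stays inside [ball x r]. *)
have [j _ /(_ j (leqnn j)) /= jr] :=
  near_infty_natSinv_lt (PosNum (divr_gt0 r0 (ltr0n _ 2))).
have j0 : 0 < j.+1%:R^-1 :> R by rewrite invr_gt0.
have [s [xs /= Ss]] : ball x (j.+1%:R^-1) `&` S !=set0.
  apply: dS; last exact: open_mball.
  by exists x; exact: ballxx.
have [i _ fi] : range f s by rewrite (image_eq f).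
exists (pickle (i, j)) => //; rewrite /V pickleK /= fi.
have sx : ball s (j.+1%:R^-1) `<=` O.
  move=> y sy; apply: xr; apply: le_ball (ball_triangle xs sy).
  by rewrite ltW// (splitr r) ltrD.
rewrite ifT; first exact: ball_sym.
apply/eqP; apply: (@subset_measure0 _ (borel E) _ mu _ _ _ _ sx O0).
  exact: open_borel (@open_mball _ _).
exact: open_borel oO.
Qed.

Lemma mdist_set0 (x : E) (A : set E) : A x -> mdist_set x A = 0.
Proof.
move=> Ax; apply/eqP; rewrite eq_le mdist_set_ge0 andbT.
rewrite -(mdistxx x); apply: ge_inf; last by exists x.
by exists 0 => _ [y _ <-]; exact: mdist_ge0.
Qed.

End borel_metric.

Section approx_integral.
Context (R : realType) (E U : pmetricType R) (b : E).
Context (P : U -> E -> probability (borel E) R) (mu : probability (borel E) R).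
Local Notation B := (mcball b).

(** Makes [c_approx] a convex combination of [c] and [inf (range c)], and [P_approx] a kernel of
    total mass one. *)
Lemma max_min_dist (d : R) : Num.max (1 - d) 0 + Num.min d 1 = 1.
Proof. by case: (leP d 1) => d1; rewrite ?maxEle ?minEle; case: ifPn; lra. Qed.

Lemma integral_P_approx n a x (f : E -> \bar R) :
  (forall y, 0 <= f y)%E -> measurable_fun [set: borel E] (f : borel E -> \bar R) ->
  (\int[P_approx b P mu n a x]_y f y =
   (Num.max (1 - mdist_set x (B n)) 0)%:E * \int[P a x]_(y in B n) f y +
   (fine (P a x (~` B n)) +
      Num.min (mdist_set x (B n)) 1 * (1 - fine (P a x (~` B n))))%:E *
   \int[mu]_y f y)%E.
Proof.
move=> f0 mf.
have mB : measurable (B n : set (borel E)) := measurable_mcball b n.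
have mC : measurable (~` B n : set (borel E)) by exact: measurableC.
have r1_ge0 : 0 <= Num.max (1 - mdist_set x (B n)) 0.
  by rewrite le_max lexx orbT.
have p1 : fine (P a x (~` B n)) <= 1.
  by rewrite -lee_fin fineK ?probability_le1//; exact: fin_num_measure.
have r2_ge0 : 0 <= fine (P a x (~` B n)) +
    Num.min (mdist_set x (B n)) 1 * (1 - fine (P a x (~` B n))).
  rewrite addr_ge0 ?fine_ge0// mulr_ge0 ?subr_ge0//.
  by rewrite le_min mdist_set_ge0 ler01.
rewrite (@eq_measure_integral _ _ _ _ (measure_add
   (mscale (NngNum r1_ge0) (mrestr (P a x) mB)) (mscale (NngNum r2_ge0) mu))).
  rewrite ge0_integral_measure_add// !ge0_integral_mscale//.
  by rewrite integral_mrestr.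
move=> A mA _; rewrite [RHS]measure_addE /= /mscale /= /P_approx /mrestr.
congr (_ + _)%E; rewrite muleC; congr (_ * _)%E.
by rewrite EFinD EFinM EFinB fineK// fin_num_measure.
Qed.

End approx_integral.

(** * Exhaustion of the space by closed balls *)

Section mcball_theory.
Context (R : realType) (E : pmetricType R) (b : E).

Lemma mcball_le m n : (m <= n)%N -> mcball b m `<=` mcball b n.
Proof. by move=> mn x /le_trans; apply; rewrite ler_nat. Qed.

Lemma mcball_near (x : E) : exists2 m, (0 < m)%N &
  \forall y \near x, mcball b m y.
Proof.
pose r := mdist b x + 1.
exists (Num.bound r).+1 => //; apply/nbhs_ballP; exists 1 => //= y.
rewrite ballEmdist /= => xy; rewrite /mcball /=.
rewrite (le_trans (metric_triangle b x y))//.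
rewrite (@le_trans _ _ r)//; first by rewrite lerD2l ltW.
rewrite (@le_trans _ _ (Num.bound r)%:R) ?ler_nat// ltW// archi_boundP//.
by rewrite addr_ge0// mdist_ge0.
Qed.

Lemma mcball_nearoo (x : E) : \forall n \near \oo, mcball b n x.
Proof.
have [m _ /nbhs_singleton xm] := mcball_near x.
by exists m => // n /= mn; exact: mcball_le xm.
Qed.

(** Continuity from above: the complements of the balls decrease to the empty set. This tightness
    localises the integrals in the passage to the limit. *)
Lemma mcballC_cvg (P : probability (borel E) R) (e : R) : 0 < e ->
  exists m : nat, fine (P (~` mcball b m)) <= e.
Proof.
move=> e0.
have mC m : measurable (~` mcball b m : set (borel E)).
  by apply: measurableC; exact: measurable_mcball.
have cap0 : \bigcap_m (~` mcball b m) = set0.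
  apply/seteqP; split => // x /= H.
  have [m _ /nbhs_singleton xm] := mcball_near x.
  exact: H xm.
have : P \o (fun m => ~` mcball b m) @ \oo --> P (\bigcap_m (~` mcball b m)).
  apply: nonincreasing_cvg_mu => //.
  - by rewrite ltey_eq fin_num_measure.
  - by rewrite cap0; exact: measurable0.
  - move=> m n mn; apply/subsetPset; apply: subsetC; exact: mcball_le.
rewrite cap0 measure0 => /fine_cvgP[_ /cvgrPdist_le/(_ _ e0)[m _ /(_ m (leqnn m))]].
rewrite sub0r normrN /= ger0_norm ?fine_ge0// => me.
by exists m.
Qed.

End mcball_theory.

(** * Continuity of the kernels in total variation *)

Section kernel_continuity.
Context (R : realType) (E U : pmetricType R).
Context (P : U -> E -> probability (borel E) R).
Hypothesis P_tv : forall (xs : nat -> E) (x : E) (us : nat -> U) (a : U),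
  us @ \oo --> a -> xs @ \oo --> x ->
  ereal_sup [set `|P (us k) (xs k) A - P a x A|%E |
             A in (measurable : set (set (borel E)))]
    @[k --> \oo] --> 0%E.
Context (c : E * U -> R).
Hypothesis c_continuous : continuous c.

(** Turns the sequential hypothesis into a neighbourhood statement: otherwise offending pairs in the
    balls of radius [1 / (k + 1)] would form a sequence contradicting [P_tv]. *)
Lemma total_variation_near x a (e : R) : 0 < e ->
  \forall ya \near (x, a), forall A : set (borel E), measurable A ->
    `|fine (P ya.2 ya.1 A) - fine (P a x A)| <= e.
Proof.
move=> e0; apply: contrapT => H.
have /choice[s sP] : forall k : nat, exists ya : E * U,
    ball (x, a) (k.+1%:R^-1) ya /\
    ~ forall A : set (borel E), measurable A ->
      `|fine (P ya.2 ya.1 A) - fine (P a x A)| <= e.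
  move=> k; apply: contrapT => /forallNP Hk; apply: H.
  apply/nbhs_ballP; exists (k.+1%:R^-1); first by rewrite /= invr_gt0.
  by move=> ya yaB; have /not_andP[//|/contrapT] := Hk ya.
have sx : (fun k => (s k).1) @ \oo --> x.
  apply/cvg_ballP => r r0; near=> k.
  have [[+ _] _] := sP k; apply: le_ball; apply: ltW.
  by near: k; exact: (near_infty_natSinv_lt (PosNum r0)).
have sa : (fun k => (s k).2) @ \oo --> a.
  apply/cvg_ballP => r r0; near=> k.
  have [[_ +] _] := sP k; apply: le_ball; apply: ltW.
  by near: k; exact: (near_infty_natSinv_lt (PosNum r0)).
have /(_ [set z | z < e%:E]%E) := P_tv sa sx.
case.
  suff : nbhs (0 : R) (fun r : R => (r%:E < e%:E)%E) by [].
  apply/nbhs_ballP; exists e => //= r; rewrite /ball /= sub0r normrN => re.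
  by rewrite lte_fin (le_lt_trans _ re)// ler_norm.
move=> k _ /(_ k (leqnn k)) /= ke; have [_] := sP k; apply => A mA.
rewrite -lee_fin; apply/ltW/le_lt_trans/ke; apply: ereal_sup_ubound.
exists A => //.
by rewrite -[in LHS](@fineK _ (P _ _ A)) ?fin_num_measure//
  -[in LHS](@fineK _ (P a x A)) ?fin_num_measure.
Unshelve. all: by end_near. Qed.

(** The expression under the supremum in the Bellman equation without the factor [e^(-lambda)], so
    that one modulus of continuity serves all the approximating equations. *)
Definition weighted_kernel (x : E) (a : U) (f : E -> R) : R :=
  expR (c (x, a)) * \int[P a x]_y (f : borel E -> R) y.
Local Notation K := weighted_kernel.

(** The difference splits into the variation of [expR \o c] times an expectation in [[0, 1]], and a
    total-variation term times [expR (c (x, a))]; neither bound depends on [f]. *)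
Lemma weighted_kernel_near x a (e : R) : 0 < e ->
  \forall ya \near (x, a), forall f : E -> R, unit_mfun (f : borel E -> R) ->
    `|K ya.1 ya.2 f - K x a f| <= e.
Proof.
move=> e0; have e20 : 0 < e / 2 by rewrite divr_gt0.
have econt : (expR \o c) ya @[ya --> (x, a)] --> expR (c (x, a)).
  exact: continuous_comp (@c_continuous (x, a)) (@continuous_expR R _).
move/cvgrPdist_le : econt => /(_ _ e20) near1.
have e30 : 0 < e / 2 / expR (c (x, a)) by rewrite divr_gt0// expR_gt0.
have near2 := total_variation_near x a e30.
near=> ya => f uf.
have : `|expR (c (x, a)) - expR (c ya)| <= e / 2 by near: ya.
have : forall A : set (borel E), measurable A ->
    `|fine (P ya.2 ya.1 A) - fine (P a x A)| <= e / 2 / expR (c (x, a)).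
  by near: ya.
move/Rintegral_total_variation => /(_ _ uf); rewrite ler_pdivlMr ?expR_gt0//.
have /andP[I0 I1] := Rintegral_unit (P ya.2 ya.1) uf.
have Ec := expR_gt0 (c (x, a)).
rewrite distrC /K -surjective_pairing => H1 H2.
rewrite (_ : _ - _ = (expR (c ya) - expR (c (x, a))) * (\int[P ya.2 ya.1]_y f y) -
  (\int[P a x]_y f y - \int[P ya.2 ya.1]_y f y) * expR (c (x, a))); last by ring.
rewrite (le_trans (ler_normB _ _))// [leRHS](splitr e); apply: lerD.
  rewrite normrM (ger0_norm I0) distrC -[leRHS]mulr1.
  by apply: ler_pM.
by rewrite normrM (gtr0_norm Ec).
Unshelve. all: by end_near. Qed.

(** For [a'] near a fixed [a], both [K y a' f] and [K x a' f] are within [e / 2] of [K x a f];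
    compactness of [U] makes the neighbourhood of [x] common to all controls. *)
Lemma weighted_kernel_near_unif (U_compact : compact [set: U]) x (e : R) : 0 < e ->
  \forall y \near x, forall a (f : E -> R), unit_mfun (f : borel E -> R) ->
    `|K y a f - K x a f| <= e.
Proof.
move=> e0; have e20 : 0 < e / 2 by rewrite divr_gt0.
have /compact_near_coveringP cov := U_compact.
suff H : \forall y \near x, [set: U] `<=`
    (fun a => forall f : E -> R, unit_mfun (f : borel E -> R) ->
      `|K y a f - K x a f| <= e).
  by near=> y => a; apply: (near H y).
apply: cov => a _.
have [[A B] /= [Ax Ba] AB] := weighted_kernel_near x a e20.
exists (B, A) => //= -[a' y] /= [Ba' Ay] f uf.
have H1 := AB (y, a') (conj Ay Ba') f uf.
have H2 := AB (x, a') (conj (nbhs_singleton Ax) Ba') f uf.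
rewrite (_ : _ - _ = (K y a' f - K x a f) - (K x a' f - K x a f)); last by ring.
by rewrite (le_trans (ler_normB _ _))// [leRHS](splitr e) lerD.
Unshelve. all: by end_near. Qed.

End kernel_continuity.

(** * Ultralimits of the approximating solutions *)

(** If [A] belongs to a filter finer than the image, its preimage belongs to [G]: otherwise the
    preimage of the complement does, and the finer filter contains two disjoint sets. *)
Lemma fmap_ultra (T1 T2 : Type) (f : T1 -> T2) (G : set_system T1) :
  UltraFilter G -> UltraFilter (f @ G).
Proof.
move=> UG; split; first exact: fmap_proper_filter.
move=> H PH GH; apply/seteqP; split => // A HA.
have [//|GA] := in_ultra_setVsetC (f @^-1` A) UG.
have /GH HC : (f @ G) (~` A) by [].
by have [t []] := filter_ex (filterI HA HC).
Qed.

Section ultralimit.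
Context (R : realType) (E U : pmetricType R) (b : E).
Context (P : U -> E -> probability (borel E) R) (c : E * U -> R).
Local Notation B := (mcball b).
Local Notation K := (weighted_kernel P c).
Hypothesis ball_compact : forall n : nat, (0 < n)%N -> compact (B n).
Hypothesis U_compact : compact [set: U].
Hypothesis P_tv : forall (xs : nat -> E) (x : E) (us : nat -> U) (a : U),
  us @ \oo --> a -> xs @ \oo --> x ->
  ereal_sup [set `|P (us k) (xs k) A - P a x A|%E |
             A in (measurable : set (set (borel E)))]
    @[k --> \oo] --> 0%E.
Hypothesis c_continuous : continuous c.
Context (h_ F_ : nat -> E -> R) (lam_ : nat -> R) (M : R).
Hypothesis M_gt0 : 0 < M.
Hypothesis lam_bound : forall n, (0 < n)%N -> expR (- lam_ n) <= M.
Hypothesis F_unit : forall n, (0 < n)%N -> unit_mfun (F_ n : borel E -> R).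
Hypothesis F_ball : forall n y, (0 < n)%N -> B n y -> F_ n y = h_ n y.
(** The supremum enters through two one-sided conditions, which pass to the limit separately; no
    maximising control is assumed. *)
Hypothesis h_ge : forall n x a, (0 < n)%N -> B n x ->
  expR (- lam_ n) * K x a (F_ n) <= h_ n x.
Hypothesis h_le : forall n x (e : R), (0 < n)%N -> B n x -> 0 < e ->
  exists a, h_ n x <= expR (- lam_ n) * K x a (F_ n) + e.

Lemma approximant_unit n y : (0 < n)%N -> B n y -> 0 <= h_ n y <= 1.
Proof. by move=> n0 Bny; rewrite -F_ball//; case: (F_unit n0). Qed.

(** Absorbs the factors [expR (- lam_ n)], all bounded by [M], whatever the sign of [d]. *)
Lemma ler_scale_bound (l d e : R) :
  0 <= l -> l <= M -> 0 <= e -> d <= e / M -> l * d <= e.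
Proof.
move=> l0 lM e0 de; rewrite (le_trans (ler_wpM2l l0 de))//.
rewrite (le_trans (ler_wpM2r _ lM)) ?divr_ge0 ?(ltW M_gt0)//.
by rewrite mulrC divfK ?gt_eqF.
Qed.

(** A near-optimal control at [y] may also be used at [x], so the loss is only the variation of [K]
    for that control. *)
Lemma approximant_oscillation n x y (e : R) : 0 < e -> (0 < n)%N -> B n x -> B n y ->
  (forall a f, unit_mfun (f : borel E -> R) -> K y a f - K x a f <= e / M) ->
  h_ n y - h_ n x <= e.
Proof.
move=> e0 n0 Bx By Ke; apply/ler_addgt0Pr => d d0.
have [a ha] := h_le n0 By d0.
have := ha; have := h_ge a n0 Bx; have := Ke a _ (F_unit n0).
have := lam_bound n0; have := expR_gt0 (- lam_ n).
set l := expR _; set k1 := K _ _ _; set k2 := K _ _ _ => l0 lM k12 k2h hk1.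
have := ler_scale_bound (ltW l0) lM (ltW e0) k12; rewrite mulrBr.
by lra.
Qed.

(** The oscillation bound applies in both directions once [B n] contains a neighbourhood of [x], and
    the modulus of [K] does not depend on [n]. *)
Lemma approximants_equicontinuous x (e : R) : 0 < e ->
  \forall y \near x & n \near \oo, (0 < n)%N /\ `|h_ n y - h_ n x| <= e.
Proof.
move=> e0; have eM : 0 < e / M by rewrite divr_gt0.
have [m m0 Bm] := mcball_near b x.
have near1 := weighted_kernel_near_unif P_tv c_continuous U_compact x eM.
have Bx := nbhs_singleton Bm.
exists ((mcball b m) `&` [set y | forall a f, unit_mfun (f : borel E -> R) ->
     `|K y a f - K x a f| <= e / M], [set n | (m <= n)%N]) => /=.
  by split; [exact: filterI|exists m].
move=> [y n] /= [[By yK] mn].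
have n0 := leq_trans m0 mn; split => //.
have [Bnx Bny] := (mcball_le mn Bx, mcball_le mn By).
rewrite ler_norml lerBlDl lerNl opprB; apply/andP; split.
  apply: approximant_oscillation => // a f uf; have := yK a f uf.
  by rewrite ler_norml => /andP[+ _]; lra.
rewrite -lerBlDl; apply: approximant_oscillation => // a f uf; have := yK a f uf.
by rewrite ler_norml => /andP[].
Qed.

Context (G : set_system nat) {UG : UltraFilter G}.
Hypothesis G_oo : \oo `<=` G.
Context (lam : R).
Hypothesis lam_cvg : lam_ @ G --> lam.

Lemma near_G_pos : \forall n \near G, (0 < n)%N.
Proof. by apply: G_oo; exists 1%N. Qed.

Lemma near_G_ball x : \forall n \near G, B n x.
Proof. by apply: G_oo; exact: mcball_nearoo. Qed.

Lemma ultralimit_exists x : exists l : R, h_ ^~ x @ G --> l.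
Proof.
have := @segment_compact R 0 1; rewrite compact_ultra => /(_ (h_ ^~ x @ G)).
case; first exact: fmap_ultra.
  suff : \forall n \near G, `[0, 1]%classic (h_ n x) by [].
  apply: filterS (filterI near_G_pos (near_G_ball x)) => n [n0 Bx] /=.
  by rewrite in_itv /=; exact: approximant_unit.
by move=> l [_ lcvg]; exists l.
Qed.

Definition ultralimit x : R := sval (cid (ultralimit_exists x)).
Local Notation h := ultralimit.

Lemma ultralimit_cvg x : h_ ^~ x @ G --> h x.
Proof. by rewrite /h; case: cid. Qed.

Lemma ultralimit_unit x : 0 <= h x <= 1.
Proof.
have near1 : \forall n \near G, 0 <= h_ n x <= 1.
  near=> n; apply: approximant_unit; near: n; [exact: near_G_pos|exact: near_G_ball].
apply/andP; split.
  by apply: (cvgr_to_ge (@ultralimit_cvg x)); apply: filterS near1 => n /andP[].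
by apply: (cvgr_to_le (@ultralimit_cvg x)); apply: filterS near1 => n /andP[].
Unshelve. all: by end_near. Qed.

Lemma ultralimit_near x (e : R) : 0 < e -> \forall y \near x, `|h y - h x| <= e.
Proof.
move=> e0; have [[A N] /= [Ax NN] AN] := approximants_equicontinuous x e0.
apply: filterS Ax => y Ay.
have : (fun n => `|h_ n y - h_ n x|) @ G --> `|h y - h x|.
  by apply: cvg_norm; apply: cvgB; exact: ultralimit_cvg.
move/cvgr_to_le; apply; near=> n.
have nN : N n by near: n; exact: G_oo.
by have [] := AN (y, n) (conj Ay nN).
Unshelve. all: by end_near. Qed.

Lemma ultralimit_continuous : continuous h.
Proof.
move=> x; apply/cvgrPdist_le => e e0.
by apply: filterS (ultralimit_near x e0) => y; rewrite distrC.
Qed.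

Lemma ultralimit_mfun : unit_mfun (h : borel E -> R).
Proof.
by split; [apply: continuous_borel; exact: ultralimit_continuous|exact: ultralimit_unit].
Qed.

(** A third of [e] each pays for equicontinuity of [h_], convergence at [x] and continuity of the
    limit. *)
Lemma ultralimit_near2 x (e : R) : 0 < e ->
  \forall y \near (x : E) & n \near G, `|h_ n y - h y| <= e.
Proof.
move=> e0; have e3 : 0 < e / 3 by rewrite divr_gt0.
have [[A N] /= [Ax NN] AN] := approximants_equicontinuous x e3.
have near1 := ultralimit_near x e3.
have /cvgrPdist_le/(_ _ e3) near2 := @ultralimit_cvg x.
exists (A `&` [set y | `|h y - h x| <= e / 3], N `&` [set n | `|h x - h_ n x| <= e / 3]).
  by split; [exact: filterI|apply: filterI => //; exact: G_oo].
move=> [y n] /= [[Ay hy] [Nn hn]].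
have [_ /=] := AN (y, n) (conj Ay Nn).
by move: hy hn; rewrite !ler_norml; lra.
Qed.

Lemma ultralimit_unif m (e : R) : (0 < m)%N -> 0 < e ->
  \forall n \near G, forall y, B m y -> `|h_ n y - h y| <= e.
Proof.
move=> m0 e0; have /compact_near_coveringP := ball_compact m0.
move=> /(_ nat G (fun n y => `|h_ n y - h y| <= e)); apply.
by move=> x _; exact: ultralimit_near2.
Qed.

(** Dominated convergence concerns sequences and can fail along an ultrafilter. Here the convergence
    is uniform on a ball that carries all but [e / 2] of the mass of [P a x], and elsewhere the
    integrands differ by at most one. *)
Lemma ultralimit_integral x a :
  \int[P a x]_y (F_ n : borel E -> R) y @[n --> G] --> \int[P a x]_y (h : borel E -> R) y.
Proof.
apply/cvgrPdist_le => e e0; have e20 : 0 < e / 2 by rewrite divr_gt0.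
have [m0 Pm0] := mcballC_cvg b (P a x) e20.
(* The successor makes the radius positive, as compactness is assumed for positive radii only. *)
pose m := m0.+1.
have mB : measurable (B m : set (borel E)) by exact: measurable_mcball.
have mC : measurable (~` B m : set (borel E)) by exact: measurableC.
have Pm : fine (P a x (~` B m)) <= e / 2.
  rewrite (le_trans _ Pm0)// fine_le ?fin_num_measure//.
    by apply: measurableC; exact: measurable_mcball.
  apply: le_measure; rewrite ?inE//.
    by apply: measurableC; exact: measurable_mcball.
  by apply: subsetC; exact: mcball_le.
have uh := ultralimit_mfun.
near=> n.
have n0 : (0 < n)%N by near: n; exact: near_G_pos.
have mn : (m <= n)%N by near: n; apply: G_oo; exists m.
have hn : forall y, B m y -> `|h_ n y - h y| <= e / 2.
  by near: n; exact: ultralimit_unif.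
have uF := F_unit n0.
have uC := unit_mfun_indic R mC.
rewrite -RintegralB//; try exact: unit_integrable.
have mhF : measurable_fun [set: borel E] (fun y : borel E => h y - F_ n y).
  by apply: measurable_funB; [case: uh|case: uF].
have hF1 y : `|h y - F_ n y| <= 1.
  case: uh => _ /(_ y) /andP[? ?]; case: uF => _ /(_ y) /andP[? ?].
  by rewrite ler_norml; lra.
rewrite (le_trans (le_normr_Rintegral _ _))//.
  exact: (bounded_mfun_integrable _ mhF hF1).
apply: (@le_trans _ _ (\int[P a x]_y (e / 2 + \1_(~` B m) y))).
  apply: le_Rintegral => //.
  - apply: (@bounded_mfun_integrable _ _ _ _ _ 1).
      exact: measurableT_comp.
    by move=> y; rewrite normr_id.
  - apply: (@bounded_mfun_integrable _ _ _ _ _ (e / 2 + 1)).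
      apply: measurable_funD; first exact: measurable_cst.
      by case: uC.
    move=> y; case: uC => _ /(_ y) /andP[? ?].
    by rewrite ger0_norm; lra.
  - move=> y _; have [By|By] := pselect (B m y).
      rewrite indicE memNset//= addr0 F_ball//; last exact: mcball_le By.
      by rewrite distrC; exact: hn.
    rewrite indicE mem_set//= (le_trans (hF1 y))//; lra.
rewrite RintegralD//; last 2 first.
- by apply: (@bounded_mfun_integrable _ _ _ _ _ (e / 2)) => // y; rewrite ger0_norm// ltW.
- exact: unit_integrable.
by rewrite Rintegral_cst_prob Rintegral_indicT// [leRHS](splitr e) lerD2l.
Unshelve. all: by end_near. Qed.

Lemma ultralimit_kernel x a :
  expR (- lam_ n) * K x a (F_ n) @[n --> G] --> expR (- lam) * K x a h.
Proof.
apply: cvgM.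
  have lN : - lam_ n @[n --> G] --> - lam by apply: cvgN.
  exact: continuous_cvg (@continuous_expR R _) lN.
by apply: cvgM; [exact: cvg_cst|exact: ultralimit_integral].
Qed.

Lemma ultralimit_ge x a : expR (- lam) * K x a h <= h x.
Proof.
apply: ler_cvg_to (@ultralimit_kernel x a) (@ultralimit_cvg x) _.
near=> n; apply: h_ge; near: n; [exact: near_G_pos|exact: near_G_ball].
Unshelve. all: by end_near. Qed.

(** Near-optimal controls [a_ n] converge along [G] to some [a] by compactness of [U]. Half of [e]
    pays for near-optimality, half for replacing [a_ n] by [a] in the kernel, uniformly in
    [F_ n]. *)
Lemma ultralimit_le x (e : R) : 0 < e ->
  exists a, h x <= expR (- lam) * K x a h + e.
Proof.
move=> e0; have e20 : 0 < e / 2 by rewrite divr_gt0.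
have eM : 0 < e / 2 / M by rewrite divr_gt0.
(* The default [point] is taken when [n = 0] or [x] is not in [B n]; neither occurs eventually along
   [G]. *)
have /choice[a_ aP] : forall n, exists a, (0 < n)%N -> B n x ->
    h_ n x <= expR (- lam_ n) * K x a (F_ n) + e / 2.
  move=> n; have [n0|] := ltnP 0%N n; last by exists point.
  have [Bx|] := pselect (B n x); last by exists point.
  by have [a ha] := h_le n0 Bx e20; exists a.
have := U_compact; rewrite compact_ultra => /(_ (a_ @ G)).
case; [exact: fmap_ultra|exact: filterT|].
move=> a [_ /= a_a]; exists a.
have [[A V] /= [Ax Va] AV] := weighted_kernel_near P_tv c_continuous x a eM.
have near1 : \forall n \near G, V (a_ n) by exact: a_a.
have cvg2 : expR (- lam_ n) * K x a (F_ n) + e @[n --> G] --> expR (- lam) * K x a h + e.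
  by apply: cvgD; [exact: ultralimit_kernel|exact: cvg_cst].
apply: ler_cvg_to (@ultralimit_cvg x) cvg2 _.
near=> n.
have n0 : (0 < n)%N by near: n; exact: near_G_pos.
have Bx : B n x by near: n; exact: near_G_ball.
have Va_n : V (a_ n) by near: n.
have := AV (x, a_ n) (conj (nbhs_singleton Ax) Va_n) (F_ n) (F_unit n0) => /=.
rewrite ler_norml => /andP[_].
have := aP n n0 Bx; have := lam_bound n0; have := expR_gt0 (- lam_ n).
set l := expR _; set k1 := K _ _ _; set k2 := K _ _ _ => l0 lM hk k12.
have := ler_scale_bound (ltW l0) lM (ltW e20) k12; rewrite mulrBr.
by lra.
Unshelve. all: by end_near. Qed.

Lemma ultralimit_solution : exists h : E -> R,
  [/\ continuous h, unit_mfun (h : borel E -> R),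
      forall x, h_ ^~ x @ G --> h x,
      forall x a, expR (- lam) * K x a h <= h x &
      forall x (e : R), 0 < e -> exists a, h x <= expR (- lam) * K x a h + e].
Proof.
exists ultralimit; split.
- exact: ultralimit_continuous.
- exact: ultralimit_mfun.
- exact: @ultralimit_cvg.
- exact: ultralimit_ge.
- exact: ultralimit_le.
Qed.

End ultralimit.

(** * The Bellman equation on a ball *)

Section bellman_approx.
Context (R : realType) (E U : pmetricType R) (b : E).
Context (P : U -> E -> probability (borel E) R) (mu : probability (borel E) R).
Context (c : E * U -> R).
Local Notation B := (mcball b).
Hypothesis c_bounded : bounded_fun c.
Hypothesis mu_ball : mu (~` B 1) = 0%E.
Context (n : nat) (w : E -> R) (lam : R).
Hypothesis w_continuous : continuous w.
Hypothesis w_bounded : bounded_fun w.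
Hypothesis w_bellman : forall x, (expR (w x))%:E = ereal_sup (range (fun a : U =>
  (expR (c_approx b c n x a - lam))%:E *
  \int[P_approx b P mu n a x]_y (expR (w y))%:E))%E.
Hypothesis w_sup : ereal_sup [set (w x)%:E | x in B n.+1] = 0%E.

Local Notation H := (fun y => expR (w y)).

Let mB k : measurable (B k : set (borel E)). Proof. exact: measurable_mcball. Qed.
Let mC k : measurable (~` B k : set (borel E)). Proof. exact: measurableC. Qed.

Lemma c_approx_ge x a : inf (range c) <= c_approx b c n x a.
Proof.
have : inf (range c) <= c (x, a).
  by apply: ge_inf; [exact: bounded_fun_has_lbound|exists (x, a)].
have := @max_min_dist R (mdist_set x (B n)); rewrite /c_approx.
have : 0 <= Num.max (1 - mdist_set x (B n)) 0 by rewrite le_max lexx orbT.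
by move: (Num.max _ _) (Num.min _ _) => r s; nra.
Qed.

Lemma c_approx_le x a : c_approx b c n x a <= c (x, a).
Proof.
have : inf (range c) <= c (x, a).
  by apply: ge_inf; [exact: bounded_fun_has_lbound|exists (x, a)].
have := @max_min_dist R (mdist_set x (B n)); rewrite /c_approx.
have : 0 <= Num.min (mdist_set x (B n)) 1 by rewrite le_min mdist_set_ge0 ler01.
by move: (Num.max _ _) (Num.min _ _) => r s; nra.
Qed.

Lemma c_approx_in x a : B n x -> c_approx b c n x a = c (x, a).
Proof.
move=> Bx; rewrite /c_approx mdist_set0// subr0.
by rewrite max_l ?ler01// min_l ?ler01// mul1r mul0r addr0.
Qed.

Lemma exp_w_le1 y : B n.+1 y -> H y <= 1.
Proof.
move=> By; rewrite -expR0 ler_expR -lee_fin.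
by rewrite -[leRHS]w_sup; apply: ereal_sup_ubound; exists y.
Qed.

Lemma exp_w_mfun : measurable_fun [set: borel E] (H : borel E -> R).
Proof.
by apply: measurableT_comp; [exact: measurable_expR|exact: continuous_borel].
Qed.

(** The cut-off makes [H] a function into [[0, 1]] when [k <= n.+1]; the case [k = n] serves
    [P a x], and [k = 1] serves [mu], which is carried by [B 1]. *)
Definition w_cut (k : nat) (y : E) : R := H y * \1_(B k) y.

Lemma w_cut_unit k : (k <= n.+1)%N -> unit_mfun (w_cut k : borel E -> R).
Proof.
move=> kn; split.
  by apply: measurable_funM; [exact: exp_w_mfun|exact: measurable_indic].
move=> y; rewrite /w_cut indicE; have [yB|yB] := boolP (y \in B k).
  rewrite mulr1 expR_ge0/= exp_w_le1//.
  by apply: mcball_le kn _ _; exact: set_mem.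
by rewrite mulr0 lexx ler01.
Qed.

Lemma integral_w_cut (Q : probability (borel E) R) k : (k <= n.+1)%N ->
  (\int[Q]_(y in B k) (H y)%:E = (\int[Q]_y (w_cut k : borel E -> R) y)%:E)%E.
Proof.
move=> kn; rewrite -Rintegral_EFin; last exact: w_cut_unit.
rewrite integral_mkcond; apply: eq_integral => y _.
by rewrite patchE /w_cut indicE; case: ifPn => yB; rewrite ?mulr1 ?mulr0.
Qed.

Definition w_mu : R := \int[mu]_y (w_cut 1 : borel E -> R) y.

Lemma integral_w_mu : (\int[mu]_y (H y)%:E = w_mu%:E)%E.
Proof.
rewrite /w_mu -integral_w_cut; last by rewrite ltnS.
have mH : measurable_fun [set: borel E] (fun y : borel E => (H y)%:E).
  by apply/measurable_EFinP; exact: exp_w_mfun.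
rewrite -(setUv (B 1)) ge0_integral_setU//=; last 2 first.
- by rewrite setUv.
- by rewrite disj_set2E setICr.
rewrite [X in (_ + X)%E](_ : _ = 0%E) ?adde0//.
rewrite (@eq_measure_integral _ _ _ _ mzero) ?integral_measure_zero//.
move=> A mA AB; exact: (@subset_measure0 _ (borel E) _ mu _ _ mA (mC 1) AB mu_ball).
Qed.

Lemma w_mu_unit : 0 <= w_mu <= 1.
Proof. by apply: Rintegral_unit; apply: w_cut_unit. Qed.

Local Notation r1 x := (Num.max (1 - mdist_set x (B n)) 0).
Local Notation q a x := (fine (P a x (~` B n))).
Local Notation r2 a x := (q a x + Num.min (mdist_set x (B n)) 1 * (1 - q a x)).
Local Notation J a x := (\int[P a x]_y (w_cut n : borel E -> R) y).

Definition w_mean a x : R := r1 x * J a x + r2 a x * w_mu.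

Lemma integral_w_mean a x :
  (\int[P_approx b P mu n a x]_y (H y)%:E = (w_mean a x)%:E)%E.
Proof.
rewrite integral_P_approx//; last first.
  by apply/measurable_EFinP; exact: exp_w_mfun.
by rewrite integral_w_cut// integral_w_mu.
Qed.

Lemma bellman_ge x a : expR (c_approx b c n x a - lam) * w_mean a x <= H x.
Proof.
rewrite -lee_fin w_bellman; apply: ereal_sup_ubound; exists a => //.
by rewrite integral_w_mean.
Qed.

Lemma bellman_le x (e : R) : 0 < e ->
  exists a, H x <= expR (c_approx b c n x a - lam) * w_mean a x + e.
Proof.
move=> e0; have /(ub_ereal_sup_adherent e0) : ereal_sup (range (fun a : U =>
  (expR (c_approx b c n x a - lam))%:E *
  \int[P_approx b P mu n a x]_y (expR (w y))%:E))%E \is a fin_num.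
  by rewrite -w_bellman.
rewrite -w_bellman => -[_ [a _ <-]]; rewrite integral_w_mean -EFinB -EFinM lte_fin => ha.
by exists a; lra.
Qed.

Let q_unit a x : 0 <= q a x <= 1.
Proof.
rewrite fine_ge0//= -lee_fin fineK ?probability_le1//; exact: fin_num_measure.
Qed.

(** This is the total mass of [P_approx], since [P a x] gives mass [1 - q a x] to [B n]. *)
Let P_approx_mass a x : r1 x * (1 - q a x) + r2 a x = 1.
Proof. by have := @max_min_dist R (mdist_set x (B n)); nra. Qed.

Let r2_ge0 a x : 0 <= r2 a x.
Proof.
have /andP[q0 q1] := q_unit a x; rewrite addr_ge0// mulr_ge0 ?subr_ge0//.
by rewrite le_min mdist_set_ge0 ler01.
Qed.

Let r1_ge0 x : 0 <= r1 x.
Proof. by rewrite le_max lexx orbT. Qed.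

Let fine_ball a x : fine (P a x (B n)) = 1 - q a x.
Proof.
rewrite probability_setC// fineB ?fin_num_measure//=; lra.
Qed.

Lemma w_mean_le1 a x : w_mean a x <= 1.
Proof.
have J1 : J a x <= 1 - q a x.
  rewrite -fine_ball -Rintegral_indicT//; apply: le_Rintegral => //.
  - by apply: unit_integrable; exact: w_cut_unit.
  - by apply: unit_integrable; exact: unit_mfun_indic.
  - move=> y _; rewrite /w_cut indicE.
    have [yB|] := boolP (y \in B n); rewrite ?mulr0// mulr1.
    apply: exp_w_le1; apply: (@mcball_le _ _ _ n) => //; exact: set_mem.
have /andP[g0 g1] := w_mu_unit.
rewrite /w_mean -[leRHS](P_approx_mass a x) lerD//.
  by rewrite ler_wpM2l// r1_ge0.
by rewrite -[leRHS]mulr1 ler_wpM2l// r2_ge0.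
Qed.

Lemma w_mean_ge a x (d : R) : 0 <= d -> (forall y, d <= H y) -> d <= w_mean a x.
Proof.
move=> d0 dH.
have J1 : d * (1 - q a x) <= J a x.
  rewrite -fine_ball -Rintegral_indicT//.
  rewrite -RintegralZl//; last by apply: unit_integrable; exact: unit_mfun_indic.
  apply: le_Rintegral => //.
  - apply: (@bounded_mfun_integrable _ _ _ _ _ `|d|).
      by apply: measurable_funM; [exact: measurable_cst|exact: measurable_indic].
    move=> y; rewrite normrM indicE; case: (_ \in _);
      rewrite ?normr0 ?mulr0 ?normr1 ?mulr1//.
  - by apply: unit_integrable; exact: w_cut_unit.
  - move=> y _; rewrite /w_cut indicE; case: (_ \in _); rewrite ?mulr0// !mulr1//.
have g1 : d <= w_mu.
  rewrite -lee_fin -integral_w_mu -[leLHS]mule1 -(probability_setT mu).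
  rewrite -integral_cst//; apply: ge0_le_integral => //.
    by apply/measurable_EFinP; exact: exp_w_mfun.
  by move=> y _; rewrite lee_fin.
rewrite /w_mean -[leLHS]mulr1 -[in leLHS](P_approx_mass a x) mulrDr lerD//.
  by rewrite mulrCA ler_wpM2l// r1_ge0.
by rewrite mulrC ler_wpM2l// r2_ge0.
Qed.

(** Were [lam] below [inf (range c)], the equation would multiply the lower bound [d] of [H] by a
    factor greater than one, although [d] is the greatest lower bound. *)
Lemma lam_ge : inf (range c) <= lam.
Proof.
have wb : has_lbound (range w) by exact: bounded_fun_has_lbound.
pose d := expR (inf (range w)).
have Hd y : d <= H y.
  by rewrite ler_expR; apply: ge_inf => //; exists y.
rewrite leNgt; apply/negP => lamc.
have lam1 : 1 < expR (inf (range c) - lam) by rewrite expR_gt1 subr_gt0.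
have step y : expR (inf (range c) - lam) * d <= H y.
  apply: le_trans (bellman_ge y point); apply: ler_pM => //; rewrite ?expR_ge0//.
    by rewrite ler_expR lerB// c_approx_ge.
  by apply: w_mean_ge => //; exact: expR_ge0.
have : ln (expR (inf (range c) - lam) * d) <= inf (range w).
  apply: lb_le_inf; first by exists (w point); exists point.
  move=> _ [y _ <-]; rewrite -ler_expR lnK ?posrE ?mulr_gt0 ?expR_gt0//.
rewrite -ler_expR lnK ?posrE ?mulr_gt0 ?expR_gt0// -/d.
by rewrite ger_pMl ?expR_gt0// leNgt lam1.
Qed.

(** Where [H] is nearly one and the control nearly optimal, [w_mean <= 1] forces the cost up to
    almost [lam]. This yields both the upper bound on [lam] and the localisation under (iii). *)
Lemma near_maximiser (d : R) : 0 < d -> exists x a,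
  [/\ B n.+1 x, expR (- d) <= H x & lam - d <= c (x, a)].
Proof.
move=> d0; have ed1 : expR (- d) < 1 by rewrite expR_lt1 oppr_lt0.
(* Chosen so that [1 - 2 * e = expR (- d)]: one [e] is lost to the near-maximum and one to the
   near-optimal control. *)
pose e : R := (1 - expR (- d)) / 2.
have e0 : 0 < e by rewrite divr_gt0 ?subr_gt0.
have e1 : 0 < 1 - e by have := expR_gt0 (- d); rewrite /e; lra.
have : ((ln (1 - e))%:E < ereal_sup [set (w x)%:E | x in B n.+1])%E.
  by rewrite w_sup lte_fin ln_lt0// e1/=; lra.
move=> /ereal_sup_gt[_ [x Bx <-]]; rewrite lte_fin -ltr_expR lnK ?posrE// => Hx.
have [a ha] := bellman_le x e0; exists x, a; split => //.
  by move: Hx; rewrite /e; have := expR_gt0 (- d); lra.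
have : expR (c_approx b c n x a - lam) * w_mean a x <= expR (c (x, a) - lam).
  rewrite -[leRHS]mulr1 ler_pM ?expR_ge0 ?w_mean_le1//.
    by apply: w_mean_ge => // y; rewrite expR_ge0.
  by rewrite ler_expR lerB// c_approx_le.
move=> Hc; have : expR (- d) <= expR (c (x, a) - lam).
  by move: Hx ha Hc; rewrite /e; lra.
by rewrite ler_expR; lra.
Qed.

Lemma lam_le : lam <= sup (range c).
Proof.
apply/ler_addgt0Pr => d d0; have [x [a [_ _ H]]] := near_maximiser d0.
rewrite -lerBlDr (le_trans H)//; apply: ub_le_sup; last by exists (x, a).
exact: bounded_fun_has_ubound.
Qed.

(** The [F_n] of the opening comment. From [x] in [B n] the approximating kernel restarts at [mu]
    whatever mass leaves [B n]; moving the restart into the integrand leaves an expectation under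
    [P a x] itself. *)
Definition w_ext (y : E) : R := w_cut n y + w_mu * \1_(~` B n) y.

Lemma w_ext_unit : unit_mfun (w_ext : borel E -> R).
Proof.
have /andP[g0 g1] := w_mu_unit.
have [mc c01] : unit_mfun (w_cut n : borel E -> R) by exact: w_cut_unit.
split.
  apply: measurable_funD => //.
  by apply: measurable_funM; [exact: measurable_cst|exact: measurable_indic].
move=> y; rewrite /w_ext; have := c01 y; rewrite /w_cut !indicE in_setC.
by case: (y \in B n); rewrite /= ?mulr0 ?mulr1 ?addr0 ?add0r// g0.
Qed.

Lemma w_ext_in y : B n y -> w_ext y = H y.
Proof.
by move=> /mem_set By; rewrite /w_ext /w_cut !indicE in_setC By/= mulr1 mulr0 addr0.
Qed.

Lemma w_meanE x a : B n x -> w_mean a x = \int[P a x]_y (w_ext : borel E -> R) y.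
Proof.
move=> Bx; rewrite /w_mean mdist_set0// subr0 max_l ?ler01// min_l ?ler01//.
rewrite mul1r mul0r addr0 RintegralD//; last 2 first.
- by apply: unit_integrable; exact: w_cut_unit.
- have /andP[g0 g1] := w_mu_unit.
  apply: (@bounded_mfun_integrable _ _ _ _ _ 1).
    by apply: measurable_funM; [exact: measurable_cst|exact: measurable_indic].
  by move=> y; rewrite indicE; case: (_ \in _); rewrite ?mulr0 ?normr0// mulr1 ger0_norm.
rewrite RintegralZl//; last by apply: unit_integrable; exact: unit_mfun_indic.
by rewrite Rintegral_indicT// [w_mu * _]mulrC.
Qed.

Lemma bellman_ge_in x a : B n x -> expR (- lam) * weighted_kernel P c x a w_ext <= H x.
Proof.
move=> Bx; have := bellman_ge x a; rewrite w_meanE// c_approx_in//.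
by rewrite /weighted_kernel mulrA -expRD addrC.
Qed.

Lemma bellman_le_in x (e : R) : B n x -> 0 < e ->
  exists a, H x <= expR (- lam) * weighted_kernel P c x a w_ext + e.
Proof.
move=> Bx e0; have [a] := bellman_le x e0; rewrite w_meanE// c_approx_in// => ha.
by exists a; rewrite /weighted_kernel mulrA -expRD [- lam + _]addrC.
Qed.

(** The [mu] term is nonnegative and is dropped; [lam <= sup (range c)] gives a constant free of
    [n], as the uniform bound under (iv) requires. *)
Lemma bellman_subkernel x a : B n x ->
  ((expR (inf (range c) - sup (range c)))%:E * \int[P a x]_(y in B n) (H y)%:E
     <= (H x)%:E)%E.
Proof.
move=> Bx; rewrite integral_w_cut// -EFinM lee_fin.
apply: le_trans (bellman_ge x a).
have cu : unit_mfun (w_cut n : borel E -> R) by exact: w_cut_unit.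
have /andP[J0 J1] := Rintegral_unit (P a x) cu.
apply: ler_pM => //; rewrite ?expR_ge0//.
  by rewrite ler_expR lerB ?c_approx_ge ?lam_le.
rewrite /w_mean mdist_set0// subr0 max_l ?ler01// mul1r lerDl mulr_ge0//.
  by have := r2_ge0 a x; rewrite mdist_set0.
by case/andP: w_mu_unit.
Qed.

End bellman_approx.

(** There are indices [f k >= k] with [u (f k)] within [1 / (k + 1)] of the limit superior; the
    image under [f] of an ultrafilter finer than [\oo] has both properties. *)
Lemma limn_sup_ultra (R : realType) (u : nat -> R) : bounded_fun u ->
  exists G : set_system nat,
    [/\ UltraFilter G, \oo `<=` G & u @ G --> limn_sup u].
Proof.
move=> bu.
have lE : limn_sup u = inf (range (sups u)) := limn_supE bu.
set l := limn_sup u in lE *.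
have lbS : has_lbound (range (sups u)) by exact: bounded_fun_has_lbound_sups.
have ubd k : has_ubound (sdrop u k).
  exact/has_ubound_sdrop/bounded_fun_has_ubound.
have /choice[f fP] : forall k : nat, exists n, (k <= n)%N /\ `|l - u n| < k.+1%:R^-1.
  move=> k; pose e : R := k.+1%:R^-1; have e0 : 0 < e by rewrite invr_gt0.
  (* From [N] on, all values are below [l + e]; beyond [k'] some value exceeds
     [sups u k' - e >= l - e]. *)
  have [_ [N _ <-] Ne] : exists2 y, range (sups u) y & y < l + e.
    rewrite lE; apply: inf_adherent => //; split => //.
    by exists (sups u 0%N); exists 0%N.
  pose k' := maxn k N.
  have ls : l <= sups u k' by rewrite lE; apply: ge_inf => //; exists k'.
  have [_ [n /= kn <-] nl] : exists2 y, sdrop u k' y & sups u k' - e < y.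
    apply: sup_adherent => //; split => //.
    by exists (u k'); exists k' => /=.
  have nN : u n <= sups u N.
    by apply: ub_le_sup => //; exists n => //=; exact: leq_trans (leq_maxr k N) kn.
  exists n; split; first exact: leq_trans (leq_maxl k N) kn.
  by rewrite -/e ltr_norml; move: Ne ls nl nN; lra.
have [G0 [UG0 G0oo]] := @ultraFilterLemma _ (\oo : set_system nat) _.
exists (f @ G0); split; first exact: fmap_ultra.
  move=> A [N _ NA]; suff : \forall k \near G0, A (f k) by [].
  apply: G0oo; exists N => // k /= Nk; apply: NA => /=.
  by apply: leq_trans Nk _; case: (fP k).
apply/cvgrPdist_lt => e e0.
suff : \forall k \near G0, `|l - u (f k)| < e by [].
apply: G0oo; near=> k; have [_ H] := fP k; apply: lt_trans H _.
by near: k; exact: (near_infty_natSinv_lt (PosNum e0)).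
Unshelve. all: by end_near. Qed.

(** * Iterated subtransition kernels *)

Section subtransition.
Context (R : realType) (E U : pmetricType R) (b : E).
Context (P : U -> E -> probability (borel E) R).
Local Notation B := (mcball b).

Lemma P_hat_ge0 n a s x (A : set (borel E)) : (0 <= P_hat b P n a s x A)%E.
Proof.
elim: s a x => [|a' s IH] a x /=; first exact: measure_ge0.
by apply: integral_ge0 => y _.
Qed.

(** A Chebyshev bound along several steps: [d^-1 * g] dominates the indicator of [A], and each
    integration over [B n] costs a factor [k^-1]. *)
Lemma P_hat_le n (g : E -> R) (k d : R) (A : set (borel E)) :
  0 < k -> 0 < d -> measurable_fun [set: borel E] (g : borel E -> R) ->
  (forall y, 0 <= g y) ->
  (forall y a, B n y -> (k%:E * \int[P a y]_(z in B n) (g z)%:E <= (g y)%:E)%E) ->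
  measurable A -> (forall y, A y -> d <= g y) ->
  forall s a x, B n x ->
    (P_hat b P n a s x A <= ((k ^+ (size s).+1 * d)^-1 * g x)%:E)%E.
Proof.
move=> k0 d0 mg g0 gk mA Ad.
have mB : measurable (B n : set (borel E)) by exact: measurable_mcball.
(* The function [u] is not assumed measurable, so that the step applies to [P_hat] itself. *)
have step (C : R) (u : borel E -> \bar R) a x : 0 <= C -> B n x ->
    (forall y, 0 <= u y)%E -> (forall y, B n y -> u y <= (C * g y)%:E)%E ->
    (\int[P a x]_(y in B n) u y <= (k^-1 * C * g x)%:E)%E.
  move=> C0 Bx u0 uC.
  apply: (@le_trans _ _ (\int[P a x]_(y in B n) (C%:E * (g y)%:E))%E).
    by apply: ge0_le_integral_nonmeas => // y By; rewrite -EFinM uC.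
  rewrite ge0_integralZl//; last 2 first.
  - by apply/measurable_EFinP; apply: measurable_funS mg.
  - by move=> y _; rewrite lee_fin.
  rewrite mulrAC mulrC EFinM; apply: lee_wpmul2l => //.
  by rewrite EFinM muleC lee_pdivlMr// muleC gk.
elim=> [|a' s IH] a x Bx /=.
  rewrite expr1 invfM -(integral_indic (P a x) mB mA); apply: step => //.
  - by rewrite invr_ge0 ltW.
  - move=> y _; rewrite lee_fin indicE; have [yA|_] := boolP (y \in A).
      by rewrite ler_pdivlMl// mulr1; apply: Ad; exact: set_mem.
    by rewrite mulr_ge0// invr_ge0 ltW.
rewrite exprS -mulrA invfM; apply: step => //.
- by rewrite invr_ge0 ltW// mulr_gt0// exprn_gt0.
- by move=> y; exact: P_hat_ge0.
- by move=> y By; exact: IH.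
Qed.

End subtransition.

(** * The limit equation *)

Section bellman_solution.
Context (R : realType) (E U : pmetricType R) (b : E).
Context (P : U -> E -> probability (borel E) R) (c : E * U -> R) (lam : R).
Local Notation B := (mcball b).
Local Notation K := (weighted_kernel P c).
Context (h : E -> R).
Hypothesis h_continuous : continuous h.
Hypothesis h_mfun : unit_mfun (h : borel E -> R).
Hypothesis h_ge : forall x a, expR (- lam) * K x a h <= h x.

(** The limit inequality gives [h] the one-step property required by [P_hat_le], and a superlevel
    set of [h] around [x0] is open, hence reached from [x] with positive probability within a ball
    containing both points. *)
Lemma bellman_solution_gt0 (x0 : E) : bounded_fun c -> 0 < h x0 ->
  (forall (n : nat) (x : E) (O : set E), (0 < n)%N ->
     B n x -> open O -> O `&` B n !=set0 ->
     exists (a : U) (s : seq U), (0 < P_hat b P n a s x O)%E) ->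
  forall x, 0 < h x.
Proof.
move=> cb hx0 reach x; have [mh h01] := h_mfun.
pose d := h x0 / 2; have d0 : 0 < d by rewrite divr_gt0.
pose O := h @^-1` [set r | d < r].
have oO : open O.
  by move/continuousP : h_continuous; apply; exact: open_gt.
have [m1 m10 /nbhs_singleton Bx] := mcball_near b x.
have [m2 m20 /nbhs_singleton Bx0] := mcball_near b x0.
pose n := maxn m1 m2; have n0 : (0 < n)%N by rewrite (leq_trans m10)// leq_maxl.
have Bnx : B n x by apply: mcball_le Bx; exact: leq_maxl.
have [|a [s]] := reach n x O n0 Bnx oO.
  exists x0; split; last by apply: mcball_le Bx0; exact: leq_maxr.
  by rewrite /O /= /d; lra.
pose k := expR (inf (range c) - lam); have k0 : 0 < k by exact: expR_gt0.
have mO : measurable (O : set (borel E)) by exact: open_borel.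
have mB : measurable (B n : set (borel E)) by exact: measurable_mcball.
have hk y a' : B n y -> (k%:E * \int[P a' y]_(z in B n) (h z)%:E <= (h y)%:E)%E.
  move=> By; apply: (@le_trans _ _ (k%:E * \int[P a' y]_z (h z)%:E)%E).
    apply: lee_wpmul2l; first by rewrite lee_fin ltW.
    apply: ge0_subset_integral => //.
      exact/measurable_EFinP.
    by move=> z _; rewrite lee_fin; case/andP: (h01 z).
  rewrite Rintegral_EFin// -EFinM lee_fin; apply: le_trans (h_ge y a').
  rewrite /K mulrA -expRD ler_wpM2r//.
    by case/andP: (Rintegral_unit (P a' y) h_mfun).
  rewrite ler_expR addrC lerD2l; apply: ge_inf; last by exists (y, a').
  exact: bounded_fun_has_lbound.
have h0 y : 0 <= h y by case/andP: (h01 y).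
have Oh (y : E) : O y -> d <= h y by exact: ltW.
have := P_hat_le k0 d0 mh h0 hk mO Oh s a Bnx => H /lt_le_trans/(_ H).
by rewrite lte_fin pmulr_rgt0// invr_gt0 mulr_gt0// exprn_gt0.
Qed.

Hypothesis h_gt0 : forall x, 0 < h x.
Hypothesis h_le : forall x (e : R), 0 < e ->
  exists a, h x <= expR (- lam) * K x a h + e.

(** The equation is homogeneous in [exp w], so dividing [h] by its supremum preserves it; positivity
    of [h] makes the logarithm continuous. *)
Lemma bellman_normalized : exists w : E -> R,
  [/\ continuous w,
      ereal_sup (range (fun x => (w x)%:E)) = 0%E &
      forall x : E,
        (expR (w x))%:E = ereal_sup (range (fun a : U =>
          (expR (c (x, a) - lam))%:E *
          \int[P a x]_y (expR (w y))%:E))%E].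
Proof.
have [mh h01] := h_mfun.
have hub : has_ubound (range h) by exists 1 => _ [y _ <-]; case/andP: (h01 y).
pose s := sup (range h).
have hs x : h x <= s by apply: ub_le_sup => //; exists x.
have s0 : 0 < s by apply: lt_le_trans (hs point); exact: h_gt0.
have hw x : expR (ln (h x / s)) = h x / s by rewrite lnK// posrE divr_gt0.
have us : unit_mfun ((fun x => h x / s) : borel E -> R).
  split; first by apply: measurable_funM => //; exact: measurable_cst.
  move=> y; apply/andP; split; first by rewrite ltW// divr_gt0.
  by rewrite ler_pdivrMr// mul1r.
have Is x a : \int[P a x]_y (h y / s : R) = (\int[P a x]_y (h : borel E -> R) y) / s.
  rewrite mulrC -RintegralZl//; last exact: unit_integrable.
  by apply: eq_Rintegral => y _; rewrite mulrC.
exists (fun x => ln (h x / s)); split.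
- move=> x; have xs0 : 0 < h x / s by rewrite divr_gt0.
  apply: (@continuous_comp _ _ _ (fun x => h x / s) (@ln R)).
    by apply: cvgM; [exact: h_continuous|exact: cvg_cst].
  exact: continuous_ln.
- apply/eqP; rewrite eq_le; apply/andP; split.
    apply: ge_ereal_sup => _ [x _ <-]; rewrite lee_fin ln_le0//.
    by rewrite ler_pdivrMr// mul1r.
  apply/lee_addgt0Pr => e e0.
  (* A point where [h] exceeds [s * expR (- e)] has [w] above [- e]. *)
  have : s * expR (- e) < sup (range h).
    by rewrite -/s -[ltRHS]mulr1 ltr_pM2l// expR_lt1 oppr_lt0.
  move=> /sup_gt[|_ [x _ <-] hx]; first by exists (h point); exists point.
  apply: (@le_trans _ _ ((ln (h x / s))%:E + e%:E)%E).
    rewrite -EFinD lee_fin -lerBlDr sub0r -[leLHS]expRK.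
    rewrite ler_ln ?posrE ?expR_gt0 ?divr_gt0//.
    by rewrite ler_pdivlMr// mulrC ltW.
  by apply: leeD => //; apply: ereal_sup_ubound; exists x.
- move=> x.
  have IE a : ((expR (c (x, a) - lam))%:E * \int[P a x]_y (expR (ln (h y / s)))%:E)%E
      = (expR (- lam) * K x a h / s)%:E.
    under eq_integral do rewrite hw.
    by rewrite Rintegral_EFin// Is -EFinM /K expRD; congr (_%:E); ring.
  rewrite hw; apply/eqP; rewrite eq_le; apply/andP; split.
    apply/lee_addgt0Pr => e e0.
    (* The tolerance [e * s] becomes [e] after division by [s]. *)
    have [a ha] := h_le x (mulr_gt0 e0 s0).
    apply: (@le_trans _ _ ((expR (- lam) * K x a h / s)%:E + e%:E)%E).
      by rewrite -EFinD lee_fin ler_pdivrMr// mulrDl divfK ?gt_eqF.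
    by apply: leeD => //; apply: ereal_sup_ubound; exists a.
  apply: ge_ereal_sup => _ [a _ <-]; rewrite IE lee_fin.
  by rewrite ler_pM2r ?invr_gt0.
Qed.

End bellman_solution.

Theorem theorem1p5 (R : realType) (E U : pmetricType R) (b : E)
    (E_lc : locally_compact [set: E])
    (E_separable : exists2 S : set E, countable S & dense S)
    (ball_compact : forall n : nat, (0 < n)%N -> compact (mcball b n))
    (U_compact : compact [set: U])
    (P : U -> E -> probability (borel E) R)
    (P_measurable : forall D : set (borel E), measurable D ->
       measurable_fun [set: borel (E * U)]
         (fun xa : borel (E * U) => P xa.2 xa.1 D))
    (c : E * U -> R)
    (c_continuous : continuous c)
    (c_bounded : bounded_fun c)
    (c_not_constant : ~ exists r : R, forall xa, c xa = r)
    (c_sup_ge0 : 0 <= sup (range c))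
    (mu : probability (borel E) R)
    (mu_support : msupport mu `<=` mcball b 1)
    (E_not_compact : ~ compact [set: E])
    (cond_i : forall (xs : nat -> E) (x : E) (us : nat -> U) (a : U),
       us @ \oo --> a -> xs @ \oo --> x ->
       ereal_sup [set `|P (us k) (xs k) A - P a x A|%E |
                  A in (measurable : set (set (borel E)))]
         @[k --> \oo] --> 0%E)
    (cond_ii : forall (n : nat) (x : E) (O : set E), (0 < n)%N ->
       mcball b n x -> open O -> O `&` mcball b n !=set0 ->
       exists (a : U) (s : seq U), (0 < P_hat b P n a s x O)%E)
    (w_ : nat -> E -> R) (lambda_ : nat -> R)
    (w_continuous : forall n : nat, (0 < n)%N -> continuous (w_ n))
    (w_bounded : forall n : nat, (0 < n)%N -> bounded_fun (w_ n))
    (w_bellman : forall (n : nat) (x : E), (0 < n)%N ->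
       (expR (w_ n x))%:E = ereal_sup (range (fun a : U =>
         (expR (c_approx b c n x a - lambda_ n))%:E *
         \int[P_approx b P mu n a x]_y (expR (w_ n y))%:E))%E)
    (w_sup : forall n : nat, (0 < n)%N ->
       ereal_sup [set (w_ n x)%:E | x in mcball b n.+1] = 0%E)
    (lambda : R) (lambda_def : lambda = limn_sup lambda_)
    (cond_iii_or_iv :
       (exists2 eps : R, 0 < eps &
          compact [set x : E |
            lambda - eps <= sup (range (fun a : U => c (x, a)))])
       \/
       (exists (x : E) (N : nat) (eps : R) (a : U) (s : seq U),
          [/\ (0 < N)%N, 0 < eps &
            (0 < ereal_inf [set P_hat b P n a s x
                              [set y | (eps < expR (w_ n y))%R]
                            | n in [set n | (N <= n)%N]])%E])) :
  exists w : E -> R,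
    [/\ continuous w,
        ereal_sup (range (fun x => (w x)%:E)) = 0%E &
        forall x : E,
          (expR (w x))%:E = ereal_sup (range (fun a : U =>
            (expR (c (x, a) - lambda))%:E *
            \int[P a x]_y (expR (w y))%:E))%E].
Proof.
have mu_ball : mu (~` mcball b 1) = 0%E.
  by apply: borel_supported mu_support => //; exact: measurable_mcball.
pose h_ n y := expR (w_ n y); pose F_ n := w_ext b mu n (w_ n).
have bell n (n0 : (0 < n)%N) := fun x => w_bellman n x n0.
have F_unit n : (0 < n)%N -> unit_mfun (F_ n : borel E -> R).
  by move=> n0; apply: w_ext_unit (w_sup n n0); exact: w_continuous.
have F_ball n y : (0 < n)%N -> mcball b n y -> F_ n y = h_ n y.
  by move=> n0 By; apply: w_ext_in.
have lam_lo n : (0 < n)%N -> inf (range c) <= lambda_ n.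
  move=> n0; exact: (lam_ge c_bounded mu_ball (w_continuous n n0) (w_bounded n n0)
    (bell n n0) (w_sup n n0)).
have lam_hi n : (0 < n)%N -> lambda_ n <= sup (range c).
  move=> n0; exact: (lam_le c_bounded mu_ball (w_continuous n n0)
    (bell n n0) (w_sup n n0)).
pose M := expR (- inf (range c)).
have M0 : 0 < M by exact: expR_gt0.
have lam_M n : (0 < n)%N -> expR (- lambda_ n) <= M.
  by move=> n0; rewrite ler_expR lerN2 lam_lo.
have lam_bounded : bounded_fun lambda_.
  (* The equations start at [n = 1], so [lambda_ 0] is arbitrary and enters the bound separately. *)
  pose D := `|lambda_ 0%N| + `|inf (range c)| + `|sup (range c)|.
  rewrite /bounded_fun /bounded_near /=; exists D; split; first exact: num_real.
  move=> N DN n _ /=; apply: le_trans (ltW DN); rewrite /D.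
  have := normr_ge0 (lambda_ 0%N); have := normr_ge0 (inf (range c)).
  have := normr_ge0 (sup (range c)).
  case: n => [|n]; first by lra.
  have := lam_lo n.+1 isT; have := lam_hi n.+1 isT.
  have := ler_norm (sup (range c)); have := ler_norm (- inf (range c)).
  by rewrite normrN ler_norml; lra.
have [G [UG G_oo]] := limn_sup_ultra lam_bounded; rewrite -lambda_def => lam_cvg.
have h_ge n x a : (0 < n)%N -> mcball b n x ->
    expR (- lambda_ n) * weighted_kernel P c x a (F_ n) <= h_ n x.
  move=> n0 Bx; exact: (bellman_ge_in mu_ball (w_continuous n n0) (bell n n0)
    (w_sup n n0) a Bx).
have h_le n x (e : R) : (0 < n)%N -> mcball b n x -> 0 < e ->
    exists a, h_ n x <= expR (- lambda_ n) * weighted_kernel P c x a (F_ n) + e.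
  move=> n0 Bx e0; exact: (bellman_le_in mu_ball (w_continuous n n0) (bell n n0)
    (w_sup n n0) Bx e0).
have [h [h_cont h_mfun hcvg hge hle]] := ultralimit_solution ball_compact U_compact
  cond_i c_continuous M0 lam_M F_unit F_ball h_ge h_le G_oo lam_cvg.
(* It remains to exclude [h = 0], since (ii) spreads positivity from one point. *)
suff [x0 hx0] : exists x0, 0 < h x0.
  apply: (bellman_normalized h_cont h_mfun hge _ hle).
  exact: (bellman_solution_gt0 h_cont h_mfun hge c_bounded hx0 cond_ii).
have near_pos : \forall n \near G, (0 < n)%N by apply: G_oo; exists 1%N.
case: cond_iii_or_iv => [[eps eps0 cK]|[x [N [eps [a [s [N0 eps0 reach]]]]]]].
  (* Under (iii): with [d = eps / 2], the cost at a near-maximiser is at least [lambda_ n - d],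
     hence at least [lambda - eps] once [lambda_ n >= lambda - d]. *)
  set K := [set x : E | _] in cK.
  pose d := eps / 2; have d0 : 0 < d by rewrite divr_gt0.
  have /choice[x_ xP] : forall n, exists x, (0 < n)%N ->
      expR (- d) <= h_ n x /\ (lambda - d <= lambda_ n -> K x).
    move=> n; case: (ltnP 0%N n) => [n0|]; last by exists point.
    have [x [a [_ Hx cx]]] := near_maximiser c_bounded mu_ball
      (w_continuous n n0) (bell n n0) (w_sup n n0) d0.
    exists x => _; split => // ln; rewrite /K /=.
    apply: (@le_trans _ _ (c (x, a))); first by move: cx ln; rewrite /d; lra.
    apply: ub_le_sup; last by exists a.
    have [C HC] := bounded_fun_has_ubound c_bounded.
    by exists C => _ [a' _ <-]; apply: HC; exists (x, a').
  have near1 : \forall n \near G, lambda - d <= lambda_ n.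
    have /cvgrPdist_le/(_ _ d0) := lam_cvg; apply: filterS => n.
    by rewrite ler_norml; lra.
  move: cK; rewrite compact_ultra => /(_ (x_ @ G)); case.
  - exact: fmap_ultra.
  - suff : \forall n \near G, K (x_ n) by [].
    by apply: filterS (filterI near_pos near1) => n [n0 ln]; case: (xP n n0) => _; exact.
  move=> x [_ /= xcvg]; exists x.
  (* Half of [expR (- d)] is given up to equicontinuity in passing from [x_ n] to the limit point
     [x]. *)
  have ed0 : 0 < expR (- d) / 2 by rewrite divr_gt0// expR_gt0.
  have [[A V] /= [Ax Voo] AV] := approximants_equicontinuous U_compact
    cond_i c_continuous M0 lam_M F_unit h_ge h_le x ed0.
  apply: lt_le_trans ed0 _; apply: (cvgr_to_ge (hcvg x)).
  have near2 : \forall n \near G, A (x_ n) by exact: xcvg.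
  have near3 : \forall n \near G, V n by exact: G_oo.
  near=> n.
  have n0 : (0 < n)%N by near: n.
  have An : A (x_ n) by near: n.
  have Vn : V n by near: n.
  have [_ /=] := AV (x_ n, n) (conj An Vn); have [+ _] := xP n n0.
  by rewrite ler_norml; lra.
(* Under (iv): [P_hat_le] with [g = h_ n] and threshold [eps] bounds [h_ n x] from below by [C * r],
   uniformly in [n]. *)
exists x.
set inf_ := ereal_inf _ in reach.
have [r r0 rinf] : exists2 r : R, 0 < r & (r%:E <= inf_)%E.
  move: reach; case: inf_ => [r| |]//; last by exists 1; rewrite // leey.
  by rewrite lte_fin => r0; exists r.
pose k := expR (inf (range c) - sup (range c)).
have k0 : 0 < k by exact: expR_gt0.
pose C := k ^+ (size s).+1 * eps.
have C0 : 0 < C by rewrite mulr_gt0// exprn_gt0.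
apply: (lt_le_trans (mulr_gt0 C0 r0)); apply: (cvgr_to_ge (hcvg x)).
near=> n.
have n0 : (0 < n)%N by near: n.
have Nn : (N <= n)%N by near: n; apply: G_oo; exists N.
have Bx : mcball b n x by near: n; apply: G_oo; exact: mcball_nearoo.
have mO : measurable ([set y | eps < h_ n y] : set (borel E)).
  have := exp_w_mfun (w_continuous n n0) => mh.
  have := mh measurableT `]eps, +oo[%classic (measurable_itv _).
  rewrite setTI; congr (measurable _); apply/seteqP.
  by split => y /=; rewrite in_itv/= andbT.
have := @P_hat_le _ _ _ b P n (h_ n) k eps _ k0 eps0 (exp_w_mfun (w_continuous n n0))
  (fun y => expR_ge0 _)
  (fun y a => @bellman_subkernel _ _ _ b P mu c c_bounded mu_ball n (w_ n) (lambda_ n)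
    (w_continuous n n0) (bell n n0) (w_sup n n0) y a) mO (fun y => @ltW _ _ _ _) s a x Bx.
rewrite -/C => H; have : (r%:E <= (C^-1 * h_ n x)%:E)%E.
  apply: le_trans H; apply: (le_trans rinf); apply: ereal_inf_lbound.
  by exists n.
by rewrite lee_fin ler_pdivlMl.
Unshelve. all: by end_near. Qed.
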